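(* Let $r\le n$, $q\le n^2$, let $\mathcal{A}:\mathbb{R}^{n\times n}\to\mathbb{R}^q$ be a linear map with $\mathcal{A}\mathcal{A}^*=\mathcal{I}_q$, let $\bm{b}\in\mathbb{R}^q$, $\lambda\ge 0$, $\kappa\ge 0$, and let $\Psi,\Phi:\mathbb{R}^{n\times r}\to\mathbb{R}\cup\{+\infty\}$ be proper closed functions. Suppose that $\Psi=\Phi$ and $\Phi$ is $\kappa$-weakly convex, and that $\mathcal{A}$ and $\bm{b}$ satisfy: (i) $\mathcal{A}^*\bm{b}$ is a symmetric matrix; and (ii) for any $U\in\mathbb{R}^{n\times n}$, $\mathcal{A}^*\mathcal{A}(U)-\big(\mathcal{A}^*\mathcal{A}(U)\big)^\top=\mathcal{A}^*\mathcal{A}\big(U-U^\top\big)$. Let $(\widetilde X,\widetilde Y)$ be an arbitrary stationary point of the problem $$\min_{X,Y\in\mathbb{R}^{n\times r}}\ \mathcal{F}_\lambda(X,Y):=\Psi(X)+\Phi(Y)+\tfrac12\|\mathcal{A}(XY^\top)-\bm{b}\|^2+\tfrac{\lambda}{2}\|X-Y\|_F^2 .$$ If $$2\lambda>\big\|\mathcal{A}^*\mathcal{A}(\widetilde X\widetilde Y^\top)\big\|+\kappa-\rho_{\min}(\mathcal{A}^*\bm{b}),$$ where $\rho_{\min}(\mathcal{A}^*\bm{b})$ denotes the smallest eigenvalue of $\mathcal{A}^*\bm{b}$, then $\widetilde X=\widetilde Y$, and $\widetilde X$ is a stationary point of the problem $$\min_{X\in\mathbb{R}^{n\times r}}\ 2\Phi(X)+\tfrac12\|\mathcal{A}(XX^\top)-\bm{b}\|^2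 .$$
   Context: $\|\cdot\|$ is the Euclidean norm for vectors and the spectral norm for matrices; $\|\cdot\|_F$ is the Frobenius norm; $\langle X,Y\rangle=\sum_{ij}X_{ij}Y_{ij}$. $\mathcal{A}^*$ is the adjoint of $\mathcal{A}$ and $\mathcal{I}_q$ the identity map on $\mathbb{R}^q$. A function is closed if it is lower semicontinuous. A proper closed function $h$ is $\kappa$-weakly convex if $h+\frac{\kappa}{2}\|\cdot\|_F^2$ is convex. The limiting subdifferential of a proper closed $h$ at $X\in\mathrm{dom}\,h$ is $\partial h(X)=\{D:\exists X^k\to X,\ h(X^k)\to h(X),\ D^k\to D,\ D^k\in\widehat\partial h(X^k)\ \forall k\}$, where the Fréchet subdifferential $\widehat\partial h(\widetilde Y)$ is the set of $D$ with $\liminf_{Y\to\widetilde Y,\,Y\ne\widetilde Y}\frac{h(Y)-h(\widetilde Y)-\langle D,Y-\widetilde Y\rangle}{\|Y-\widetilde Y\|_F}\ge 0$. A stationary point of $h$ (or of the problem $\min h$) is a point $\widetilde X$ with $0\in\partial h(\widetilde X)$. *)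

(* Defs.v *)
From HB Require Import structures.
From mathcomp Require Import all_boot all_order all_algebra.
From mathcomp Require Import all_classical all_reals all_analysis.
Set Implicit Arguments.
Unset Strict Implicit.
Unset Printing Implicit Defensive.
Import Order.TTheory GRing.Theory Num.Theory.
Import numFieldNormedType.Exports.
Local Open Scope classical_set_scope.
Local Open Scope ring_scope.

(* The library norm `|X| on matrices is the max norm; the Euclidean structure is
   defined here, for vectors as one-column matrices. The two norms induce the
   same topology, so convergence and neighborhoods are those of the library. *)

Definition frob_inner (R : realType) (m p : nat) (X Y : 'M[R]_(m, p)) : R :=
  \sum_(i < m) \sum_(j < p) X i j * Y i j.

Definition frob_norm (R : realType) (m p : nat) (X : 'M[R]_(m, p)) : R :=
  Num.sqrt (frob_inner X X).

Definition prod_inner (R : realType) (m p : nat)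
    (u v : 'M[R]_(m, p) * 'M[R]_(m, p)) : R :=
  frob_inner u.1 v.1 + frob_inner u.2 v.2.

Definition spectral_norm (R : realType) (m p : nat) (M : 'M[R]_(m, p)) : R :=
  sup [set frob_norm (M *m v) | v in [set v : 'cV[R]_p | frob_norm v <= 1]].

(* The set of eigenvalues is finite, and nonempty when M is real symmetric of
   positive size, so that this infimum is then a minimum. *)
Definition rho_min (R : realType) (n : nat) (M : 'M[R]_n) : R :=
  inf [set a : R | eigenvalue M a].

Definition adjoint (R : realType) (n q : nat)
    (A : {linear 'M[R]_n -> 'cV[R]_q}) (y : 'cV[R]_q) : 'M[R]_n :=
  \matrix_(i < n, j < n) frob_inner (A (delta_mx i j)) y.

Lemma adjointP (R : realType) (n q : nat) (A : {linear 'M[R]_n -> 'cV[R]_q})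
    (U : 'M[R]_n) (y : 'cV[R]_q) :
  frob_inner (A U) y = frob_inner U (adjoint A y).
Proof.
rewrite {1}(matrix_sum_delta U) linear_sum /frob_inner.
under eq_bigr => k _ do under eq_bigr => l _ do rewrite summxE mulr_suml.
under eq_bigr => k _ do rewrite exchange_big.
rewrite exchange_big; apply: eq_bigr => i _ /=.
under eq_bigr => k _ do under eq_bigr => l _ do
  rewrite linear_sum summxE mulr_suml.
under eq_bigr => k _ do rewrite exchange_big.
rewrite exchange_big; apply: eq_bigr => j _ /=.
rewrite mxE /frob_inner mulr_sumr; apply: eq_bigr => k _.
by rewrite mulr_sumr; apply: eq_bigr => l _; rewrite linearZ mxE mulrA.
Qed.

Local Open Scope ereal_scope.

Definition proper_fun (R : realType) (T : Type) (h : T -> \bar R) : Prop :=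
  (forall x, h x != -oo) /\ exists x, h x < +oo.

Definition econvex (R : realType) (V : lmodType R) (h : V -> \bar R) : Prop :=
  forall (x y : V) (t : R), (0 <= t <= 1)%R ->
    h (t *: x + (1 - t) *: y)%R <= t%:E * h x + (1 - t)%:E * h y.

Definition weakly_convex (R : realType) (m p : nat) (kappa : R)
    (h : 'M[R]_(m, p) -> \bar R) : Prop :=
  econvex (fun X => h X + (kappa / 2 * frob_norm X ^+ 2)%:E).

(* Subdifferentials with respect to an inner product ip on V, so that they apply
   both to R^(m x p) and to the product R^(m x p) x R^(m x p). *)

Definition frechet_subdiff (R : realType) (V : normedModType R)
    (ip : V -> V -> R) (h : V -> \bar R) (x : V) : set V :=
  [set D | h x \is a fin_num /\
    0 <= limf_einf
      (fun y => (h y - h x - (ip D (y - x)%R)%:E)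
                * (Num.sqrt (ip (y - x) (y - x)))^-1%:E) x^'].

Definition limiting_subdiff (R : realType) (V : normedModType R)
    (ip : V -> V -> R) (h : V -> \bar R) (x : V) : set V :=
  [set D | h x \is a fin_num /\
    exists (x_ D_ : nat -> V),
      [/\ x_ k @[k --> \oo] --> x,
          h (x_ k) @[k --> \oo] --> h x,
          D_ k @[k --> \oo] --> D &
          forall k, frechet_subdiff ip h (x_ k) (D_ k)]].

Definition stationary (R : realType) (V : normedModType R)
    (ip : V -> V -> R) (h : V -> \bar R) (x : V) : Prop :=
  limiting_subdiff ip h x 0%R.

Definition F_lambda (R : realType) (n r q : nat)
    (A : {linear 'M[R]_n -> 'cV[R]_q}) (b : 'cV[R]_q)
    (Psi Phi : 'M[R]_(n, r) -> \bar R) (lambda : R)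
    (Z : 'M[R]_(n, r) * 'M[R]_(n, r)) : \bar R :=
  Psi Z.1 + Phi Z.2
  + (1 / 2 * frob_norm (A (Z.1 *m Z.2^T) - b) ^+ 2)%:E
  + (lambda / 2 * frob_norm (Z.1 - Z.2) ^+ 2)%:E.

Definition sym_objective (R : realType) (n r q : nat)
    (A : {linear 'M[R]_n -> 'cV[R]_q}) (b : 'cV[R]_q)
    (Phi : 'M[R]_(n, r) -> \bar R) (X : 'M[R]_(n, r)) : \bar R :=
  2%:E * Phi X + (1 / 2 * frob_norm (A (X *m X^T) - b) ^+ 2)%:E.

(* Main.v *)
(* Fixing one block and testing the Frechet inequality along segments, weak convexity
   turns every Frechet subgradient of [F_lambda] into a pair of subgradients of [Phi]
   with a global quadratic minorant; these pass to the limit by lower semicontinuity.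
   With [M = A^*(A(X Y^T) - b)] and [D = X - Y], stationarity thus gives subgradients
   [- (M Y + lambda D)] at [X] and [- (M^T X - lambda D)] at [Y]. Hypomonotonicity of the
   subgradients of [Phi] bounds [- kappa |D|^2] from above by
     [<W D, D> - <(W - W^T) X, D> - <A^*b D, D> - 2 lambda |D|^2],  [W = A^*A(X Y^T)],
   where (ii) makes the second inner product nonnegative; the first is at most [|W| |D|^2]
   and the third at least [rho_min (A^*b) |D|^2], so the gap condition forces [D = 0].
   Then [M] is symmetric, and [- M X] being a subgradient of [Phi] at [X] is stationarity
   of the symmetric objective, whose smooth part has gradient [2 M X]. *)
Require Import Defs.
From HB Require Import structures.
From mathcomp Require Import all_boot all_order all_algebra.
From mathcomp Require Import all_classical all_reals all_analysis.
From mathcomp Require Import ring lra.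
Import Order.TTheory GRing.Theory Num.Theory.
Import numFieldNormedType.Exports.
Local Open Scope classical_set_scope.
Local Open Scope ring_scope.

(** * Algebra of the Frobenius inner product, and the spectral norm *)

Lemma frob_innerE {R : realType} {m p : nat} (X Y : 'M[R]_(m, p)) :
  frob_inner X Y = \tr (X *m Y^T).
Proof.
apply: eq_bigr => i _; rewrite mxE.
by apply: eq_bigr => j _; rewrite mxE.
Qed.

Lemma frob_innerC {R : realType} {m p : nat} (X Y : 'M[R]_(m, p)) :
  frob_inner X Y = frob_inner Y X.
Proof. by apply: eq_bigr => i _; apply: eq_bigr => j _; rewrite mulrC. Qed.

Lemma frob_innerDl {R : realType} {m p : nat} (X Y Z : 'M[R]_(m, p)) :
  frob_inner (X + Y) Z = frob_inner X Z + frob_inner Y Z.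
Proof. by rewrite !frob_innerE mulmxDl mxtraceD. Qed.

Lemma frob_innerZl {R : realType} {m p : nat} (a : R) (X Z : 'M[R]_(m, p)) :
  frob_inner (a *: X) Z = a * frob_inner X Z.
Proof. by rewrite !frob_innerE -scalemxAl mxtraceZ. Qed.

Lemma frob_innerNl {R : realType} {m p : nat} (X Z : 'M[R]_(m, p)) :
  frob_inner (- X) Z = - frob_inner X Z.
Proof. by rewrite -scaleN1r frob_innerZl mulN1r. Qed.

Lemma frob_innerDr {R : realType} {m p : nat} (X Y Z : 'M[R]_(m, p)) :
  frob_inner X (Y + Z) = frob_inner X Y + frob_inner X Z.
Proof. by rewrite frob_innerC frob_innerDl !(frob_innerC X). Qed.

Lemma frob_innerZr {R : realType} {m p : nat} (a : R) (X Z : 'M[R]_(m, p)) :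
  frob_inner X (a *: Z) = a * frob_inner X Z.
Proof. by rewrite frob_innerC frob_innerZl frob_innerC. Qed.

Lemma frob_innerNr {R : realType} {m p : nat} (X Z : 'M[R]_(m, p)) :
  frob_inner X (- Z) = - frob_inner X Z.
Proof. by rewrite frob_innerC frob_innerNl frob_innerC. Qed.

Lemma frob_inner0l {R : realType} {m p : nat} (Z : 'M[R]_(m, p)) :
  frob_inner 0 Z = 0.
Proof. by rewrite -(scale0r 0) frob_innerZl mul0r. Qed.

Definition frob_bilin := (@frob_innerDl, @frob_innerDr, @frob_innerNl,
  @frob_innerNr, @frob_innerZl, @frob_innerZr).

Lemma frob_innerT {R : realType} {m p : nat} (X Y : 'M[R]_(m, p)) :
  frob_inner X^T Y^T = frob_inner X Y.
Proof. by rewrite !frob_innerE trmxK mxtrace_mulC -[LHS]mxtrace_tr trmx_mul trmxK. Qed.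

Lemma frob_inner_mull {R : realType} {m p s : nat}
    (M : 'M[R]_(m, s)) (X : 'M[R]_(s, p)) (Y : 'M[R]_(m, p)) :
  frob_inner (M *m X) Y = frob_inner X (M^T *m Y).
Proof. by rewrite !frob_innerE trmx_mul trmxK -mulmxA mxtrace_mulC mulmxA. Qed.

Lemma frob_inner_mulr {R : realType} {m p s : nat}
    (M : 'M[R]_(m, s)) (X : 'M[R]_(s, p)) (Y : 'M[R]_(m, p)) :
  frob_inner (M *m X) Y = frob_inner M (Y *m X^T).
Proof. by rewrite !frob_innerE trmx_mul trmxK mulmxA. Qed.

Lemma frob_inner_ge0 {R : realType} {m p : nat} (X : 'M[R]_(m, p)) :
  0 <= frob_inner X X.
Proof. by apply: sumr_ge0 => i _; apply: sumr_ge0 => j _; rewrite -expr2 sqr_ge0. Qed.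

Lemma sqr_le_frob_inner {R : realType} {m p : nat} (X : 'M[R]_(m, p)) i j :
  X i j ^+ 2 <= frob_inner X X.
Proof.
rewrite /frob_inner (bigD1 i) //= (bigD1 j) //= -expr2 -addrA lerDl.
apply: addr_ge0; first by apply: sumr_ge0 => k _; rewrite -expr2 sqr_ge0.
by apply: sumr_ge0 => k _; apply: sumr_ge0 => l _; rewrite -expr2 sqr_ge0.
Qed.

Lemma frob_inner_eq0 {R : realType} {m p : nat} (X : 'M[R]_(m, p)) :
  (frob_inner X X == 0) = (X == 0).
Proof.
apply/eqP/eqP => [X0|->]; last by rewrite frob_inner0l.
apply/matrixP => i j; rewrite mxE; apply/eqP; rewrite -sqrf_eq0 eq_le sqr_ge0 andbT.
by rewrite -X0 sqr_le_frob_inner.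
Qed.

Lemma frob_inner_gt0 {R : realType} {m p : nat} (X : 'M[R]_(m, p)) :
  (0 < frob_inner X X) = (X != 0).
Proof. by rewrite lt0r frob_inner_eq0 frob_inner_ge0 andbT. Qed.

Lemma sqr_frob_norm {R : realType} {m p : nat} (X : 'M[R]_(m, p)) :
  frob_norm X ^+ 2 = frob_inner X X.
Proof. by rewrite sqr_sqrtr // frob_inner_ge0. Qed.

Lemma frob_norm_ge0 {R : realType} {m p : nat} (X : 'M[R]_(m, p)) :
  0 <= frob_norm X.
Proof. exact: sqrtr_ge0. Qed.

Lemma frob_normZ {R : realType} {m p : nat} (a : R) (X : 'M[R]_(m, p)) :
  frob_norm (a *: X) = `|a| * frob_norm X.
Proof.
by rewrite /frob_norm frob_innerZl frob_innerZr mulrA -expr2 sqrtrM ?sqr_ge0//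
  sqrtr_sqr.
Qed.

(** Expanding [|<Y, Y> X - <X, Y> Y|^2 >= 0] gives [<Y, Y>] times the difference of the two sides,
    and [<Y, Y>] is positive unless [Y = 0]. *)
Lemma frob_cauchy_sqr {R : realType} {m p : nat} (X Y : 'M[R]_(m, p)) :
  frob_inner X Y ^+ 2 <= frob_inner X X * frob_inner Y Y.
Proof.
have [->|Y0] := eqVneq Y 0.
  by rewrite frob_innerC !frob_inner0l expr0n mulr0.
have yy : 0 < frob_inner Y Y by rewrite frob_inner_gt0.
have := frob_inner_ge0 (frob_inner Y Y *: X - frob_inner X Y *: Y).
rewrite !frob_bilin (frob_innerC Y X) => h.
rewrite -subr_ge0 -(pmulr_rge0 _ yy); nra.
Qed.

Lemma frob_cauchy {R : realType} {m p : nat} (X Y : 'M[R]_(m, p)) :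
  frob_inner X Y <= frob_norm X * frob_norm Y.
Proof.
apply: le_trans (ler_norm _) _.
rewrite -(@ler_pXn2r _ 2) ?nnegrE ?mulr_ge0 ?frob_norm_ge0//.
by rewrite exprMn !sqr_frob_norm real_normK ?num_real// frob_cauchy_sqr.
Qed.

Lemma frob_inner_row {R : realType} {m p : nat} (X Y : 'M[R]_(m, p)) :
  frob_inner X Y = \sum_i frob_inner (row i X) (row i Y).
Proof.
apply: eq_bigr => i _; rewrite /frob_inner big_ord1.
by apply: eq_bigr => j _; rewrite !mxE.
Qed.

Lemma frob_inner_col {R : realType} {m p : nat} (X Y : 'M[R]_(m, p)) :
  frob_inner X Y = \sum_j frob_inner (col j X) (col j Y).
Proof.
rewrite -frob_innerT frob_inner_row; apply: eq_bigr => j _.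
by rewrite -frob_innerT !tr_row !trmxK.
Qed.

(** Cauchy-Schwarz on each row of [M]. This crude bound shows that the set defining [spectral_norm]
    is bounded. *)
Lemma frob_norm_mulmx {R : realType} {m p : nat} (M : 'M[R]_(m, p)) (v : 'cV[R]_p) :
  frob_norm (M *m v) <= frob_norm M * frob_norm v.
Proof.
rewrite -(@ler_pXn2r _ 2) ?nnegrE ?mulr_ge0 ?frob_norm_ge0// exprMn !sqr_frob_norm.
rewrite frob_inner_row [in leRHS]frob_inner_row mulr_suml; apply: ler_sum => i _.
have -> : row i (M *m v) = (frob_inner (row i M) v^T)%:M.
  apply/matrixP => k l; rewrite !ord1 row_mul [LHS]mxE mxE eqxx mulr1n.
  by rewrite /frob_inner big_ord1; apply: eq_bigr => j _; rewrite !mxE.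
rewrite {1}/frob_inner !big_ord1 mxE eqxx mulr1n -expr2 -(frob_innerT v).
exact: frob_cauchy_sqr.
Qed.

Lemma frob_norm_mul_spectral {R : realType} {m p : nat} (M : 'M[R]_(m, p))
    (v : 'cV[R]_p) : frob_norm (M *m v) <= spectral_norm M * frob_norm v.
Proof.
have [->|v0] := eqVneq v 0.
  by rewrite mulmx0 /frob_norm !frob_inner0l sqrtr0 mulr0.
have nv : 0 < frob_norm v by rewrite sqrtr_gt0 frob_inner_gt0.
rewrite -ler_pdivrMr// mulrC.
have -> : (frob_norm v)^-1 * frob_norm (M *m v) =
    frob_norm (M *m ((frob_norm v)^-1 *: v)).
  by rewrite -scalemxAr frob_normZ normfV ger0_norm ?frob_norm_ge0.
apply: ub_le_sup; last first.
  exists ((frob_norm v)^-1 *: v) => //=.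
  by rewrite frob_normZ normfV ger0_norm ?frob_norm_ge0// mulVf// gt_eqF.
(* [sup] has a default value on unbounded sets, so a bound over the unit ball must be supplied. *)
exists (frob_norm M) => _ [w /= w1 <-].
apply: le_trans (frob_norm_mulmx _ _) _.
by rewrite ler_piMr// frob_norm_ge0.
Qed.

(** Left multiplication acts column by column, which reduces the claim to vectors, where
    Cauchy-Schwarz applies. *)
Lemma frob_inner_mul_spectral {R : realType} {m p : nat} (M : 'M[R]_m)
    (X : 'M[R]_(m, p)) :
  frob_inner (M *m X) X <= spectral_norm M * frob_inner X X.
Proof.
rewrite frob_inner_col [in leRHS]frob_inner_col mulr_sumr; apply: ler_sum => j _.
rewrite colE -mulmxA -colE; apply: le_trans (frob_cauchy _ _) _.
rewrite -(sqr_frob_norm (col j X)) expr2 mulrA.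
by apply: ler_wpM2r (frob_norm_mul_spectral _ _); rewrite frob_norm_ge0.
Qed.

(** * Convergence of matrix expressions along a filter *)

Lemma cvg_mxP {R : realType} {T : Type} {F : set_system T} {FF : Filter F}
    {m p : nat} (u : T -> 'M[R]_(m, p)) (U : 'M[R]_(m, p)) :
  u x @[x --> F] --> U <-> forall i j, u x i j @[x --> F] --> U i j.
Proof.
split=> [uU i j|uU]; first exact: (continuous_cvg _ (@coord_continuous R m p i j U) uU).
apply/cvg_ballP => e e0.
have : \forall x \near F, forall i j, ball (U i j) e (u x i j).
  apply: filter_forall => i; apply: filter_forall => j.
  by move: (uU i j) => /cvg_ballP; apply.
by apply: filterS => x ?; split.
Qed.

Lemma cvg_sumr {R : realType} {T : Type} {F : set_system T} {FF : Filter F}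
    {I : finType} (f : T -> I -> R) (l : I -> R) :
  (forall i, f x i @[x --> F] --> l i) ->
  \sum_i f x i @[x --> F] --> \sum_i l i.
Proof.
move=> fl; apply: (@cvg_big _ _ _ _ _ _ _ _ _ (fun i x => f x i)) => //.
exact: add_continuous.
Qed.

Lemma cvg_frob_inner {R : realType} {T : Type} {F : set_system T} {FF : Filter F}
    {m p : nat} (u v : T -> 'M[R]_(m, p)) (U V : 'M[R]_(m, p)) :
  u x @[x --> F] --> U -> v x @[x --> F] --> V ->
  frob_inner (u x) (v x) @[x --> F] --> frob_inner U V.
Proof.
move=> /cvg_mxP uU /cvg_mxP vV; apply: cvg_sumr => i; apply: cvg_sumr => j.
exact: cvgM.
Qed.

Lemma cvg_mulmx {R : realType} {T : Type} {F : set_system T} {FF : Filter F}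
    {m p s : nat} (u : T -> 'M[R]_(m, s)) (v : T -> 'M[R]_(s, p))
    (U : 'M[R]_(m, s)) (V : 'M[R]_(s, p)) :
  u x @[x --> F] --> U -> v x @[x --> F] --> V ->
  u x *m v x @[x --> F] --> U *m V.
Proof.
move=> /cvg_mxP uU /cvg_mxP vV; apply/cvg_mxP => i j.
rewrite mxE; under eq_fun do rewrite mxE.
by apply: cvg_sumr => k; exact: cvgM.
Qed.

Lemma cvg_trmx {R : realType} {T : Type} {F : set_system T} {FF : Filter F}
    {m p : nat} (u : T -> 'M[R]_(m, p)) (U : 'M[R]_(m, p)) :
  u x @[x --> F] --> U -> (u x)^T @[x --> F] --> U^T.
Proof.
move=> /cvg_mxP uU; apply/cvg_mxP => i j.
by rewrite mxE; under eq_fun do rewrite mxE; exact: uU.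
Qed.

(** Each entry of [A M] is a finite combination of the entries of [M], with coefficients read off
    from [A (delta_mx i j)]. *)
Lemma cvg_linear_mx {R : realType} {T : Type} {F : set_system T} {FF : Filter F}
    {m p s t : nat} (A : {linear 'M[R]_(m, p) -> 'M[R]_(s, t)})
    (u : T -> 'M[R]_(m, p)) (U : 'M[R]_(m, p)) :
  u x @[x --> F] --> U -> A (u x) @[x --> F] --> A U.
Proof.
move=> /cvg_mxP uU; apply/cvg_mxP => k l.
have AE (M : 'M[R]_(m, p)) : A M k l = \sum_i \sum_j M i j * A (delta_mx i j) k l.
  rewrite {1}(matrix_sum_delta M) linear_sum summxE; apply: eq_bigr => i _.
  rewrite linear_sum summxE; apply: eq_bigr => j _.
  by rewrite linearZ mxE.
rewrite AE; under eq_fun do rewrite AE.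
apply: cvg_sumr => i; apply: cvg_sumr => j; by apply: cvgM => //; exact: cvg_cst.
Qed.

(** * The smallest eigenvalue and the Rayleigh quotient *)

Lemma quadratic_ge0_linear_eq0 {R : realType} (a k : R) :
  (forall t, 0 <= t * a + t ^+ 2 * k) -> a = 0.
Proof.
move=> h; apply/eqP; rewrite -sqrf_eq0 eq_le sqr_ge0 andbT.
(* At [t = - a / K] the hypothesis reads [0 <= (a / K)^2 (k - K)]; since [k < K], this forces
   [a = 0]. *)
pose K := `|k| + 1; have kK : k < K by rewrite ltr_pwDr// ler_norm.
have K0 : 0 < K by rewrite ltr_wpDl.
have := h (- (a / K)); set s := a / K.
have -> : a = s * K by rewrite divfK// gt_eqF.
move=> h1; have : s ^+ 2 * (K * (K - k)) <= 0 by nra.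
have : 0 < K * (K - k) by rewrite mulr_gt0// subr_gt0.
have := sqr_ge0 s; move: (s ^+ 2) => s2 ? ? ?.
have : s2 = 0 by nra.
rewrite exprMn.
nra.
Qed.

(** Each entry is bounded by the Frobenius norm, so the sphere is bounded for the max norm; it is
    closed as a preimage of a point. Row vectors suit [EVT_min_rV] and [eigenvalue]. *)
Lemma compact_frob_sphere {R : realType} (n : nat) :
  compact [set v : 'rV[R]_n | frob_inner v v = 1].
Proof.
apply: bounded_closed_compact.
  exists 1; split; rewrite ?num_real// => M M1 v /= v1.
  rewrite [leLHS]/Num.Def.normr /= mx_normrE; apply/bigmax_leP; split=> [|[i j] _ /=].
    by rewrite (le_trans _ (ltW M1)).
  apply: le_trans (ltW M1); rewrite -(@ler_pXn2r _ 2) ?nnegrE//.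
  by rewrite real_normK ?num_real// expr1n -v1 sqr_le_frob_inner.
rewrite (_ : [set v | _] = (fun v => frob_inner v v) @^-1` [set 1])//.
apply: closed_comp; last exact: closed_eq.
by move=> v _; apply: (@cvg_frob_inner R _ (nbhs v) _ _ _ id id); exact: cvg_id.
Qed.

(* The minimum of the Rayleigh quotient over the sphere is attained at some [v];
   first-order optimality of the nonnegative form of [B - m I] at [v] makes [v]
   an eigenvector with eigenvalue [m]. *)
Lemma rho_min_rayleigh {R : realType} {n : nat} (B : 'M[R]_n) (v : 'rV[R]_n) :
  B^T = B -> rho_min B * frob_inner v v <= frob_inner (v *m B) v.
Proof.
move=> Bsym.
case: n B v Bsym => [|n] B v Bsym.
  (* In size 0 the sphere is empty and has no minimizer, but both sides vanish. *)
  by rewrite (flatmx0 B) (thinmx0 v) mul0mx frob_inner0l mulr0.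
pose q (w : 'rV[R]_n.+1) := frob_inner (w *m B) w.
have [c /set_mem /= c1 cmin] : exists2 c, c \in [set v : 'rV[R]_n.+1 | frob_inner v v = 1] &
    forall t, t \in [set v : 'rV[R]_n.+1 | frob_inner v v = 1] -> q c <= q t.
  apply: EVT_min_rV; last 2 first.
  - exact: compact_frob_sphere.
  - apply: continuous_subspaceT => w.
    apply: (@cvg_frob_inner R _ (nbhs w) _ _ _ (mulmx^~ B) id); last exact: cvg_id.
    by apply: (@cvg_mulmx R _ (nbhs w) _ _ _ _ id (cst B)); [exact: cvg_id|exact: cvg_cst].
  - exists (delta_mx 0 0) => /=; rewrite frob_innerE trmx_delta mul_delta_mx.
    by rewrite /mxtrace big_ord1 mxE !eqxx.
have qZ a w : q (a *: w) = a ^+ 2 * q w.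
  by rewrite /q -scalemxAl !frob_bilin mulrA.
have qmin w : q c * frob_inner w w <= q w.
  have [->|w0] := eqVneq w 0; first by rewrite /q mul0mx !frob_inner0l mulr0.
  have nw : 0 < frob_norm w by rewrite sqrtr_gt0 frob_inner_gt0.
  have := cmin ((frob_norm w)^-1 *: w); rewrite qZ => h.
  rewrite -sqr_frob_norm -ler_pdivlMr ?exprn_gt0// mulrC -exprVn; apply: h.
  by apply: mem_set => /=; rewrite !frob_bilin -sqr_frob_norm; field; rewrite gt_eqF.
have ev : eigenvalue B (q c).
  apply/eigenvalueP; exists c; last by rewrite -frob_inner_eq0 c1 oner_eq0.
  apply/eqP; rewrite -subr_eq0 -frob_inner_eq0.
  have : frob_inner (c *m B - q c *: c) (c *m B - q c *: c) =
      frob_inner (c *m B) (c *m B - q c *: c) - q c * frob_inner c (c *m B - q c *: c).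
    by rewrite frob_innerDl frob_innerNl frob_innerZl.
  move: (c *m B - q c *: c) => w wE.
  (* With [w = c B - q(c) c], this expands [qmin] at [c + t w]: the constant terms cancel since
     [|c| = 1], and symmetry of [B] makes the linear coefficient
     [2 (<c B, w> - q(c) <c, w>) = 2 |w|^2]. *)
  have key t : 0 <= 2 * t * frob_inner w w + t ^+ 2 * (q w - q c * frob_inner w w).
    have := qmin (c + t *: w); rewrite /q mulmxDl -scalemxAl !frob_bilin.
    rewrite -/(q c) -/(q w) c1.
    have -> : frob_inner (w *m B) c = frob_inner (c *m B) w.
      by rewrite frob_inner_mulr Bsym frob_innerC.
    rewrite (frob_innerC w c) wE => h; nra.
  apply/eqP; suff : 2 * frob_inner w w = 0 by move/eqP; rewrite mulf_eq0 pnatr_eq0 => /eqP.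
  apply: (@quadratic_ge0_linear_eq0 _ _ (q w - q c * frob_inner w w)) => t.
  by rewrite mulrCA mulrA.
(* Comparing [rho_min B] with its member [q c] requires the set of eigenvalues to be bounded below;
   an eigenvector for [a] has Rayleigh quotient [a]. *)
have lb : lbound [set a : R | eigenvalue B a] (q c).
  move=> a /= /eigenvalueP[w wB w0].
  have ww : 0 < frob_inner w w by rewrite frob_inner_gt0.
  by have := qmin w; rewrite /q wB frob_innerZl ler_pM2r.
apply: le_trans (qmin v); apply: ler_wpM2r; first exact: frob_inner_ge0.
by apply: ge_inf => //; exists (q c).
Qed.

Lemma rho_min_frob_inner {R : realType} {n r : nat} (B : 'M[R]_n) (X : 'M[R]_(n, r)) :
  B^T = B -> rho_min B * frob_inner X X <= frob_inner (B *m X) X.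
Proof.
move=> Bsym; rewrite -frob_innerT -(frob_innerT (B *m X)) trmx_mul Bsym.
rewrite frob_inner_row [in leRHS]frob_inner_row mulr_sumr; apply: ler_sum => i _.
by rewrite row_mul; exact: rho_min_rayleigh.
Qed.

(** * Frechet and proximal subgradients *)

Lemma limf_einf_ge0P {R : realType} {T : choiceType} {X : filteredType T}
    (f : X -> \bar R) (F : set_system X) {FF : Filter F} :
  (0%:E <= limf_einf f F)%E <->
  forall e : R, 0 < e -> \forall y \near F, ((- e)%:E <= f y)%E.
Proof.
rewrite limf_einfE; split=> [f0 e e0|h].
  have : ((- e)%:E < ereal_sup [set ereal_inf (f @` V) | V in F])%E.
    by apply: lt_le_trans f0; rewrite lte_fin oppr_lt0.
  move=> /ereal_sup_gt[_ [V FV <-] eV]; apply: filterS FV => y Vy.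
  by apply: (le_trans (ltW eV)); apply: ereal_inf_lbound; exists y.
apply/lee_subgt0Pr => e e0; rewrite sub0e -EFinN.
apply: (@le_trans _ _ (ereal_inf (f @` [set y | (- e)%:E <= f y]%E))).
  by apply: le_ereal_inf_tmp => _ [y /= ? <-].
by apply: ereal_sup_ubound; eexists; [exact: h e0|].
Qed.

(** The Frechet inequality at [x + t v], combined with the upper bound on [h], is divided by [t] as
    [t] decreases to 0. Only homogeneity of [ip] along [v] is asked for, which is easy to check for
    [prod_inner] in a direction moving a single block. *)
Lemma frechet_subdiff_dir {R : realType} {V : normedModType R} (ip : V -> V -> R)
    (h : V -> \bar R) (x D v : V) (a c : R) :
  (forall t, ip D (t *: v) = t * ip D v) ->
  (forall t, ip (t *: v) (t *: v) = t ^+ 2 * ip v v) ->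
  0 < ip v v ->
  frechet_subdiff ip h x D ->
  (forall t : R, 0 < t <= 1 -> (h (x + t *: v)%R <= h x + (t * a + t ^+ 2 * c)%:E)%E) ->
  ip D v <= a.
Proof.
move=> ipD ipv v0 [hx /limf_einf_ge0P hF] hup.
rewrite leNgt; apply/negP => ltaD.
set N := Num.sqrt (ip v v); have N0 : 0 < N by rewrite sqrtr_gt0.
set g := ip D v - a; have g0 : 0 < g by rewrite subr_gt0.
(* With tolerance [g / (2 N)], multiplying the quotient by [t N] gives [- t g / 2 <= - t g + t^2 c],
   hence [g / 2 <= t c]; the bound [t < (g / 2) / (|c| + 1)] contradicts this. *)
have gN0 : 0 < g / 2 / N by rewrite !divr_gt0.
have c0 : 0 < g / 2 / (`|c| + 1) by rewrite !divr_gt0// ltr_wpDl.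
have vn0 : v != 0.
  apply/eqP => vE; move: v0 (ipv 0).
  by rewrite scale0r -vE expr0n mul0r => /[swap] ->; rewrite ltxx.
have := hF _ gN0; rewrite /dnbhs /within /= => near_x.
have cont : x + t *: v @[t --> (0 : R)] --> x.
  rewrite -[X in _ --> X]addr0 -[X in _ --> _ + X](scale0r v).
  by apply: cvgD; [exact: cvg_cst|apply: cvgZ; [exact: cvg_id|exact: cvg_cst]].
have near0 := cvg_at_right_filter cont near_x.
near (0 : R)^'+ => t.
have xtE : x + t *: v - x = t *: v by rewrite addrAC subrr add0r.
have t0 : 0 < t by near: t; exact: nbhs_right_gt.
have t1 : t <= 1 by near: t; exact: nbhs_right_le.
have tc : t < g / 2 / (`|c| + 1) by near: t; exact: nbhs_right_lt.
have : ((- (g / 2 / N))%:E <= (h (x + t *: v)%R - h x - (ip D (x + t *: v - x)%R)%:E)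
   * (Num.sqrt (ip (x + t *: v - x)%R (x + t *: v - x)%R))^-1%:E)%E.
  have : x + t *: v != x.
    by rewrite -subr_eq0 xtE scaler_eq0 negb_or gt_eqF.
  by near: t; exact: near0.
have := hup t; rewrite t0 t1 => /(_ isT).
rewrite xtE ipD ipv sqrtrM ?sqr_ge0// sqrtr_sqr gtr0_norm// -/N.
have tN : 0 < t * N by rewrite mulr_gt0.
move: hx; case: (h x) => [r _| |]//; case: (h (x + t *: v)) => [s| |].
- rewrite -!EFinB -EFinM -EFinD !lee_fin ler_pdivlMr// => h1 h2.
  have : g / 2 / N * (t * N) = t * (g / 2) by field; rewrite gt_eqF.
  rewrite mulNr in h2 => gE; rewrite gE in h2.
  move: tc; rewrite ltr_pdivlMr ?ltr_wpDl// => tc.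
  have := ler_norm c; move: (ler_norm c) tc.
  rewrite /g in h2 *; move: (`|c|) => c' cc' tc _.
  have : t * (g / 2) <= t * (t * c) by rewrite /g; nra.
  rewrite ler_pM2l// => h3.
  have : t * c <= t * c' by rewrite ler_pM2l.
  rewrite /g in h3; nra.
- by rewrite leye_eq.
- by rewrite /= mulNyr gtr0_sg ?invr_gt0// mul1e leeNy_eq.
Unshelve. all: by end_near. Qed.

(* Proximal subgradient with a global quadratic minorant: for weakly convex functions
   this coincides with both the Frechet and the limiting subgradients, and it passes
   to the limit by lower semicontinuity alone. *)
Definition prox_subgrad {R : realType} {m p : nat} (kappa : R)
    (Phi : 'M[R]_(m, p) -> \bar R) (X G : 'M[R]_(m, p)) : Prop :=
  Phi X \is a fin_num /\
  forall Z, (Phi X + (frob_inner G (Z - X)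
    - kappa / 2 * frob_inner (Z - X) (Z - X))%:E <= Phi Z)%E.

(** By [t |Z|^2 + (1 - t) |X|^2 - |X + t (Z - X)|^2 = t (1 - t) |Z - X|^2], weak convexity is
    convexity up to the error [t (1 - t) k]. Powers of [t] are separated to fit
    [frechet_subdiff_dir]. *)
Lemma weakly_convex_segment {R : realType} {m p : nat} (kappa : R)
    (Phi : 'M[R]_(m, p) -> \bar R) (X Z : 'M[R]_(m, p)) (t : R) :
  weakly_convex kappa Phi -> 0 < t <= 1 ->
  Phi X \is a fin_num -> Phi Z \is a fin_num ->
  let k := kappa / 2 * frob_inner (Z - X) (Z - X) in
  (Phi (X + t *: (Z - X))%R <=
   Phi X + (t * (fine (Phi Z) - fine (Phi X) + k) + t ^+ 2 * (- k))%:E)%E.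
Proof.
move=> cvx /andP[t0 t1]; have := cvx Z X t; rewrite (ltW t0) t1 => /(_ isT).
have -> : t *: Z + (1 - t) *: X = X + t *: (Z - X).
  by rewrite scalerBl scale1r scalerBr addrCA addrA.
case: (Phi X) => [x| |]//; case: (Phi Z) => [z| |]// + _ _ /=.
rewrite !sqr_frob_norm -!EFinD.
case: (Phi (_ + _)) => [s| |]; rewrite ?leNye// ?addye// ?leye_eq//.
rewrite -EFinD !lee_fin !frob_bilin !(frob_innerC Z X); nra.
Qed.

(** The test along [V = Z - X], with the slope supplied by [weakly_convex_segment], is already the
    minorant inequality at [Z]. *)
Lemma prox_subgrad_dir {R : realType} {m p : nat} (kappa : R)
    (Phi : 'M[R]_(m, p) -> \bar R) (X G : 'M[R]_(m, p)) :
  weakly_convex kappa Phi -> (forall Z, Phi Z != -oo%E) -> Phi X \is a fin_num ->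
  (forall V a c, V != 0 ->
    (forall t, 0 < t <= 1 -> (Phi (X + t *: V)%R <= Phi X + (t * a + t ^+ 2 * c)%:E)%E) ->
    frob_inner G V <= a) ->
  prox_subgrad kappa Phi X G.
Proof.
move=> cvx PhiNy PhiX h; split=> // Z.
have [->|ZX] := eqVneq Z X.
  by rewrite subrr frob_innerC !frob_inner0l mulr0 subr0 adde0.
case PhiZ : (Phi Z) => [z| |]; rewrite ?leey//; last first.
  by move: (PhiNy Z); rewrite PhiZ.
have PhiZf : Phi Z \is a fin_num by rewrite PhiZ.
have := h (Z - X) _ _ _ (fun t ht => weakly_convex_segment _ _ _ _ t cvx ht PhiX PhiZf).
rewrite subr_eq0 => /(_ ZX); rewrite PhiZ.
move: PhiX; case: (Phi X) => [x| |]//= _ hG.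
by rewrite -EFinD lee_fin; lra.
Qed.

(** For fixed [Z] the correction [s k] converges, and lower semicontinuity eventually keeps
    [Phi (u k)] above [Phi X - e / 2]; the other half of [e] absorbs the error in [s k]. *)
Lemma prox_subgrad_lim {R : realType} {m p : nat} (kappa : R)
    (Phi : 'M[R]_(m, p) -> \bar R) (u g : nat -> 'M[R]_(m, p)) (X G : 'M[R]_(m, p)) :
  lower_semicontinuous Phi -> Phi X \is a fin_num ->
  u k @[k --> \oo] --> X -> g k @[k --> \oo] --> G ->
  (forall k, prox_subgrad kappa Phi (u k) (g k)) ->
  prox_subgrad kappa Phi X G.
Proof.
move=> lsc PhiX uX gG h; split=> // Z.
have ZX : Z - u k @[k --> \oo] --> Z - X by apply: cvgB => //; exact: cvg_cst.
pose s k := frob_inner (g k) (Z - u k) - kappa / 2 * frob_inner (Z - u k) (Z - u k).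
have sl : s k @[k --> \oo] --> frob_inner G (Z - X) - kappa / 2 * frob_inner (Z - X) (Z - X).
  apply: cvgB; first exact: cvg_frob_inner.
  by apply: cvgM; [exact: cvg_cst|exact: cvg_frob_inner].
move: (frob_inner G _ - _) sl => l sl.
have hs k : (Phi (u k) + (s k)%:E <= Phi Z)%E by have [_ /(_ Z)] := h k.
move: PhiX; case PhiXE : (Phi X) => [x| |]// _.
rewrite -EFinD; apply/lee_subgt0Pr => e e0.
have e20 : 0 < e / 2 by rewrite divr_gt0.
have [|V XV hV] := lsc X (x - e / 2).
  by rewrite PhiXE lte_fin ltrBlDr ltrDl.
near \oo => k.
have uk : V (u k) by near: k; exact: uX.
have sk : l - e / 2 < s k.
  near: k; have /cvgrPdist_lt/(_ _ e20) := sl.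
  by apply: filterS => k; rewrite ltr_norml => /andP[_]; lra.
apply: le_trans (hs k); apply: le_trans (leeD2r _ (ltW (hV _ uk))).
by rewrite -EFinB -EFinD lee_fin; lra.
Unshelve. all: by end_near. Qed.

(** Add the minorant at [X] evaluated at [Y] to the minorant at [Y] evaluated at [X]; the values of
    [Phi] cancel. *)
Lemma prox_subgrad_monotone {R : realType} {m p : nat} (kappa : R)
    (Phi : 'M[R]_(m, p) -> \bar R) (X Y G H : 'M[R]_(m, p)) :
  prox_subgrad kappa Phi X G -> prox_subgrad kappa Phi Y H ->
  - kappa * frob_inner (X - Y) (X - Y) <= frob_inner (G - H) (X - Y).
Proof.
move=> [PhiX /(_ Y)] + [PhiY /(_ X)].
move: PhiX PhiY; case: (Phi X) => [x| |]//; case: (Phi Y) => [y| |]// _ _.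
rewrite -!EFinD !lee_fin -(opprB X Y).
move: (X - Y) => d; rewrite !frob_bilin; lra.
Qed.

(** The Frechet quotient is at least [- C |y - x|], which tends to 0; the radius [e / (|C| + 1)]
    makes it at least [- e]. *)
Lemma frechet_subdiff0_of_quadratic_minorant {R : realType} {m p : nat} (C : R)
    (h : 'M[R]_(m, p) -> \bar R) (x : 'M[R]_(m, p)) :
  h x \is a fin_num ->
  (forall y, (h x + (- (C * frob_inner (y - x) (y - x)))%:E <= h y)%E) ->
  frechet_subdiff (@frob_inner R m p) h x 0.
Proof.
move=> hx hmin; split=> //; apply/limf_einf_ge0P => e e0.
have d0 : 0 < e / (`|C| + 1) by rewrite divr_gt0// ltr_wpDl.
set d := e / _ in d0.
have dist0 : frob_inner (y - x) (y - x) @[y --> x] --> (0 : R).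
  rewrite -[X in _ --> X](@frob_inner0l R m p 0) -(subrr x).
  by apply: (@cvg_frob_inner R _ (nbhs x) _ _ _ (fun y => y - x) (fun y => y - x));
    apply: cvgB; [exact: cvg_id|exact: cvg_cst|exact: cvg_id|exact: cvg_cst].
have near_d : \forall y \near x, frob_inner (y - x) (y - x) < d ^+ 2.
  have /cvgrPdist_lt/(_ (d ^+ 2)) := dist0; rewrite exprn_gt0// => /(_ isT).
  by apply: filterS => y; rewrite sub0r normrN; apply: le_lt_trans; rewrite ler_norm.
rewrite /dnbhs; apply: filterS near_d => y yd yx.
have N0 : 0 < frob_norm (y - x) by rewrite sqrtr_gt0 frob_inner_gt0 subr_eq0.
have Nd : frob_norm (y - x) < d.
  by rewrite -(@ltr_pXn2r _ 2) ?nnegrE ?ltW// sqr_frob_norm.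
have := hmin y; rewrite -/(frob_norm (y - x)) frob_inner0l -sqr_frob_norm.
move: (frob_norm _) N0 Nd => N N0 Nd.
move: hx; case: (h x) => [r| |]// _; case: (h y) => [s| |]//.
- rewrite -EFinD -!EFinB -EFinM !lee_fin subr0 => rs.
  rewrite ler_pdivlMr//.
  have : C * N <= e.
    have -> : e = (`|C| + 1) * d by rewrite /d mulrC divfK// gt_eqF// ltr_wpDl.
    have := ler_norm C; have := normr_ge0 C; move: `|C| => c; nra.
  move=> CN; have : C * N * N <= e * N by rewrite ler_pM2r.
  lra.
- by move=> _; rewrite -EFinN /= mulyr gtr0_sg ?invr_gt0// mul1e leey.
Qed.

(** * The residual term, stationarity conditions and the skew part of the gradient *)

Lemma adjointB {R : realType} {n q : nat} (A : {linear 'M[R]_n -> 'cV[R]_q})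
    (y z : 'cV[R]_q) : adjoint A (y - z) = adjoint A y - adjoint A z.
Proof. by apply/matrixP => i j; rewrite !mxE frob_innerDr frob_innerNr. Qed.

Lemma cvg_adjoint {R : realType} {T : Type} {F : set_system T} {FF : Filter F}
    {n q : nat} (A : {linear 'M[R]_n -> 'cV[R]_q}) (u : T -> 'cV[R]_q) (y : 'cV[R]_q) :
  u x @[x --> F] --> y -> adjoint A (u x) @[x --> F] --> adjoint A y.
Proof.
move=> uy; apply/cvg_mxP => i j; rewrite mxE; under eq_fun do rewrite mxE.
by apply: cvg_frob_inner => //; exact: cvg_cst.
Qed.

(** The residual is affine, so the expansion is exact; it exhibits [adjoint A (A U - b)] as the
    gradient of half the squared residual. *)
Lemma sqr_residual_expand {R : realType} {n q : nat}
    (A : {linear 'M[R]_n -> 'cV[R]_q}) (b : 'cV[R]_q) (U W : 'M[R]_n) :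
  frob_inner (A (U + W) - b) (A (U + W) - b) =
  frob_inner (A U - b) (A U - b) + 2 * frob_inner W (adjoint A (A U - b))
  + frob_inner (A W) (A W).
Proof.
rewrite -adjointP linearD -addrAC.
move: (A U - b) (A W) => u w; rewrite !frob_bilin (frob_innerC w u); ring.
Qed.

(** When one block moves along a segment, the smooth part of [F_lambda] is exactly quadratic in the
    step, so an upper bound on [Phi] along the segment becomes one on [F_lambda] whose slope is
    shifted by the partial gradient. *)
Lemma frechet_subdiff_F_lambda {R : realType} {n r q : nat}
    (A : {linear 'M[R]_n -> 'cV[R]_q}) (b : 'cV[R]_q) (lambda kappa : R)
    (Phi : 'M[R]_(n, r) -> \bar R) (X Y P Q : 'M[R]_(n, r)) :
  (forall Z, Phi Z != -oo%E) -> weakly_convex kappa Phi ->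
  frechet_subdiff (@prod_inner R n r) (F_lambda A b Phi Phi lambda) (X, Y) (P, Q) ->
  let M := adjoint A (A (X *m Y^T) - b) in
  prox_subgrad kappa Phi X (P - (M *m Y + lambda *: (X - Y))) /\
  prox_subgrad kappa Phi Y (Q - (M^T *m X - lambda *: (X - Y))).
Proof.
move=> PhiNy cvx sub M.
have [PhiX PhiY] : Phi X \is a fin_num /\ Phi Y \is a fin_num.
  have [+ _] := sub; rewrite /F_lambda /=.
  move: (PhiNy X) (PhiNy Y).
  by case: (Phi X) => [x| |]//; case: (Phi Y) => [y| |].
split; apply: prox_subgrad_dir => // V a c V0 hup.
- have := @frechet_subdiff_dir R _ _ _ _ _ (V, 0)
    (a + frob_inner (M *m Y + lambda *: (X - Y)) V)
    (c + 1 / 2 * frob_inner (A (V *m Y^T)) (A (V *m Y^T)) + lambda / 2 * frob_inner V V)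
    _ _ _ sub.
  rewrite /prod_inner /= !(frob_innerC _ 0) !frob_inner0l addr0.
  rewrite frob_innerDl frob_innerNl lerBlDr; apply.
  + by move=> t; rewrite scaler0 (frob_innerC _ 0) !frob_inner0l !addr0 frob_innerZr.
  + move=> t; rewrite scaler0 !frob_inner0l !addr0 !frob_bilin; ring.
  + by rewrite addr0 frob_inner_gt0.
  move=> t ht; have := hup t ht; rewrite /F_lambda /= scaler0 addr0.
  move: PhiX PhiY (PhiNy (X + t *: V)); case: (Phi X) => [x| |]//.
  case: (Phi Y) => [y| |]//; case: (Phi (_ + _)) => [s| |]//.
  rewrite !sqr_frob_norm -!EFinD !lee_fin => _ _ _ hs.
  rewrite mulmxDl -scalemxAl sqr_residual_expand -/M (addrAC X).
  rewrite linearZ /= [frob_inner (X - Y + _) _]frob_innerDl.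
  rewrite ![frob_inner _ (X - Y + _)]frob_innerDr.
  rewrite [frob_inner (M *m Y + _) V]frob_innerDl.
  (* [<M Y, V> = <M, V Y^T>] matches the partial gradient with the linear term of the residual. *)
  rewrite [frob_inner (M *m Y) V]frob_inner_mulr (frob_innerC M).
  rewrite !frob_innerZl !frob_innerZr (frob_innerC V (X - Y)).
  lra.
- have := @frechet_subdiff_dir R _ _ _ _ _ (0, V)
    (a + frob_inner (M^T *m X - lambda *: (X - Y)) V)
    (c + 1 / 2 * frob_inner (A (X *m V^T)) (A (X *m V^T)) + lambda / 2 * frob_inner V V)
    _ _ _ sub.
  rewrite /prod_inner /= !(frob_innerC _ 0) !frob_inner0l add0r.
  rewrite frob_innerDl frob_innerNl lerBlDr; apply.
  + by move=> t; rewrite scaler0 (frob_innerC _ 0) !frob_inner0l !add0r frob_innerZr.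
  + move=> t; rewrite scaler0 !frob_inner0l !add0r !frob_bilin; ring.
  + by rewrite add0r frob_inner_gt0.
  move=> t ht; have := hup t ht; rewrite /F_lambda /= scaler0 addr0.
  move: PhiX PhiY (PhiNy (Y + t *: V)); case: (Phi X) => [x| |]//.
  case: (Phi Y) => [y| |]//; case: (Phi (_ + _)) => [s| |]//.
  rewrite !sqr_frob_norm -!EFinD !lee_fin => _ _ _ hs.
  rewrite linearD linearZ /= mulmxDr -scalemxAr sqr_residual_expand -/M opprD addrA.
  rewrite linearZ /= [frob_inner (X - Y - _) _]frob_innerDl.
  rewrite ![frob_inner _ (X - Y - _)]frob_innerDr.
  rewrite [frob_inner (M^T *m X - _) V]frob_innerDl.
  (* In the second block the match is [<M^T X, V> = <X, M V> = <M, X V^T>]. *)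
  rewrite [frob_inner (M^T *m X) V]frob_inner_mull trmxK.
  rewrite (frob_innerC X (M *m V)) [frob_inner (M *m V) X]frob_inner_mulr (frob_innerC M).
  rewrite !frob_innerNl !frob_innerNr !frob_innerZl !frob_innerZr (frob_innerC V (X - Y)).
  lra.
Qed.

(** The Frechet subgradients [D_ k] tend to 0 and the partial gradients depend continuously on the
    point, so [prox_subgrad_lim] applies in each block. *)
Lemma prox_subgrad_stationary {R : realType} {n r q : nat}
    (A : {linear 'M[R]_n -> 'cV[R]_q}) (b : 'cV[R]_q) (lambda kappa : R)
    (Phi : 'M[R]_(n, r) -> \bar R) (X Y : 'M[R]_(n, r)) :
  (forall Z, Phi Z != -oo%E) -> lower_semicontinuous Phi -> weakly_convex kappa Phi ->
  stationary (@prod_inner R n r) (F_lambda A b Phi Phi lambda) (X, Y) ->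
  let M := adjoint A (A (X *m Y^T) - b) in
  prox_subgrad kappa Phi X (- (M *m Y + lambda *: (X - Y))) /\
  prox_subgrad kappa Phi Y (- (M^T *m X - lambda *: (X - Y))).
Proof.
move=> PhiNy lsc cvx [fin [z_ [D_ [zlim _ Dlim sub]]]] M.
have [PhiX PhiY] : Phi X \is a fin_num /\ Phi Y \is a fin_num.
  move: fin; rewrite /F_lambda /=; move: (PhiNy X) (PhiNy Y).
  by case: (Phi X) => [x| |]//; case: (Phi Y) => [y| |].
have Xlim : (z_ k).1 @[k --> \oo] --> X.
  by apply: (cvg_comp _ _ zlim); exact: cvg_fst.
have Ylim : (z_ k).2 @[k --> \oo] --> Y.
  by apply: (cvg_comp _ _ zlim); exact: cvg_snd.
have Plim : (D_ k).1 @[k --> \oo] --> (0 : 'M[R]_(n, r)).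
  by apply: (cvg_comp _ _ Dlim); exact: cvg_fst.
have Qlim : (D_ k).2 @[k --> \oo] --> (0 : 'M[R]_(n, r)).
  by apply: (cvg_comp _ _ Dlim); exact: cvg_snd.
pose M_ k := adjoint A (A ((z_ k).1 *m (z_ k).2^T) - b).
have Mlim : M_ k @[k --> \oo] --> M.
  apply: cvg_adjoint; apply: cvgB; last exact: cvg_cst.
  by apply: (cvg_linear_mx A); apply: cvg_mulmx => //; exact: cvg_trmx.
have dlim : lambda *: ((z_ k).1 - (z_ k).2) @[k --> \oo] --> lambda *: (X - Y).
  by apply: cvgZ; [exact: cvg_cst|exact: cvgB].
have hk k : prox_subgrad kappa Phi (z_ k).1
      ((D_ k).1 - (M_ k *m (z_ k).2 + lambda *: ((z_ k).1 - (z_ k).2))) /\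
    prox_subgrad kappa Phi (z_ k).2
      ((D_ k).2 - ((M_ k)^T *m (z_ k).1 - lambda *: ((z_ k).1 - (z_ k).2))).
  apply: frechet_subdiff_F_lambda => //; move: (sub k).
  by case: (z_ k) => x y; case: (D_ k).
rewrite -(sub0r (M *m Y + _)) -(sub0r (M^T *m X - _)).
split; [apply: (prox_subgrad_lim _ _ _ _ _ _ lsc PhiX Xlim _ (fun k => (hk k).1))
       |apply: (prox_subgrad_lim _ _ _ _ _ _ lsc PhiY Ylim _ (fun k => (hk k).2))].
- by apply: (cvgB Plim); apply: cvgD dlim; exact: (cvg_mulmx _ _ _ _ Mlim Ylim).
- by apply: (cvgB Qlim); apply: cvgB dlim; exact: (cvg_mulmx _ _ _ _ (cvg_trmx _ _ Mlim) Xlim).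
Qed.

Lemma stationary_sym_objective {R : realType} {n r q : nat}
    (A : {linear 'M[R]_n -> 'cV[R]_q}) (b : 'cV[R]_q) (kappa : R)
    (Phi : 'M[R]_(n, r) -> \bar R) (X : 'M[R]_(n, r)) :
  let M := adjoint A (A (X *m X^T) - b) in
  M^T = M -> prox_subgrad kappa Phi X (- (M *m X)) ->
  stationary (@frob_inner R n r) (sym_objective A b Phi) X.
Proof.
move=> M Msym [PhiX hX].
have symX : sym_objective A b Phi X \is a fin_num.
  by move: PhiX; rewrite /sym_objective; case: (Phi X).
split=> //; exists (cst X), (cst 0); split.
(* Constant sequences suffice, because 0 is shown to be a Frechet subgradient at [X] itself. *)
- exact: cvg_cst.
- exact: (@cvg_cst _ (sym_objective A b Phi X)).
- exact: cvg_cst.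
(* With [d = Z - X], half the squared residual grows by at least [2 <M X, d> + <M d, d>], and
   [2 Phi] by at least [- 2 <M X, d> - kappa |d|^2]. The linear terms cancel; the spectral bound for
   [- M] controls [<M d, d>] from below. *)
move=> k; apply: (@frechet_subdiff0_of_quadratic_minorant _ _ _
  (kappa + spectral_norm (- M))) => // Z.
have := hX Z; rewrite /sym_objective.
move: PhiX; case: (Phi X) => [x| |]// _; case: (Phi Z) => [z| |]; last 2 first.
- by move=> _; rewrite mulry gtr0_sg// mul1e addye// leey.
- by rewrite leeNy_eq.
rewrite !sqr_frob_norm -!EFinM -!EFinD !lee_fin.
have -> : Z *m Z^T = X *m X^T + (X *m (Z - X)^T + (Z - X) *m X^T + (Z - X) *m (Z - X)^T).
  have {1 2}-> : Z = X + (Z - X) by rewrite addrC subrK.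
  by move: (Z - X) => d; rewrite linearD /= mulmxDl !mulmxDr !addrA.
rewrite sqr_residual_expand -/M; move: (Z - X) => d.
set AW := A (_ + _ + _).
have := frob_inner_ge0 AW; move: (frob_inner AW AW) => w.
have := frob_inner_mul_spectral (- M) d.
rewrite mulNmx !frob_innerNl !frob_innerDl.
have -> : frob_inner (X *m d^T) M = frob_inner (M *m X) d.
  by rewrite -frob_innerT trmx_mul trmxK Msym frob_innerC frob_inner_mulr.
have -> : frob_inner (d *m X^T) M = frob_inner (M *m X) d.
  by rewrite frob_innerC frob_inner_mulr.
have -> : frob_inner (d *m d^T) M = frob_inner (M *m d) d.
  by rewrite frob_innerC frob_inner_mulr.
lra.
Qed.

(* With [W = A^*A(X Y^T)] and [K = W - W^T = A^*A(X Y^T - Y X^T)], the antisymmetry of [K]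
   gives [<K X, X - Y> = |A(X Y^T - Y X^T)|^2 / 2 >= 0]. *)
Lemma skew_part_ge0 {R : realType} {n r q : nat}
    (A : {linear 'M[R]_n -> 'cV[R]_q}) (X Y : 'M[R]_(n, r)) (K : 'M[R]_n) :
  K^T = - K -> K = adjoint A (A (X *m Y^T - Y *m X^T)) ->
  0 <= frob_inner (K *m X) (X - Y).
Proof.
move=> Kskew KE.
have skew U : frob_inner K U^T = - frob_inner K U.
  by rewrite -frob_innerT Kskew trmxK frob_innerNl.
have XX : frob_inner K (X *m X^T) = 0.
  by have := skew (X *m X^T); rewrite trmx_mul trmxK; lra.
have XY : frob_inner K (X *m Y^T) = - frob_inner K (Y *m X^T).
  by rewrite -skew trmx_mul trmxK.
have : 0 <= frob_inner K (X *m Y^T - Y *m X^T).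
  by rewrite {1}KE frob_innerC -adjointP frob_inner_ge0.
(* [<K X, X - Y> = <K, X X^T - Y X^T> = - <K, Y X^T>], half of the nonnegative quantity above. *)
rewrite frob_inner_mulr mulmxBl !frob_innerDr !frob_innerNr XX XY; lra.
Qed.

Theorem theorem3p1 (R : realType) (n r q : nat)
    (hr : (r <= n)%N) (hq : (q <= n ^ 2)%N)
    (A : {linear 'M[R]_n -> 'cV[R]_q})
    (hA : forall y : 'cV[R]_q, A (adjoint A y) = y)
    (b : 'cV[R]_q) (lambda kappa : R)
    (hlambda : 0 <= lambda) (hkappa : 0 <= kappa)
    (Psi Phi : 'M[R]_(n, r) -> \bar R)
    (Psi_proper : proper_fun Psi) (Psi_closed : lower_semicontinuous Psi)
    (Phi_proper : proper_fun Phi) (Phi_closed : lower_semicontinuous Phi)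
    (hPsiPhi : Psi = Phi) (hPhi : weakly_convex kappa Phi)
    (hi : (adjoint A b)^T = adjoint A b)
    (hii : forall U : 'M[R]_n,
        adjoint A (A U) - (adjoint A (A U))^T = adjoint A (A (U - U^T)))
    (Xt Yt : 'M[R]_(n, r))
    (hstat : stationary (@prod_inner R n r) (F_lambda A b Psi Phi lambda) (Xt, Yt))
    (hgap : spectral_norm (adjoint A (A (Xt *m Yt^T))) + kappa
              - rho_min (adjoint A b) < 2 * lambda) :
  Xt = Yt /\
  stationary (@frob_inner R n r) (sym_objective A b Phi) Xt.
Proof.
subst Psi; have [PhiNy _] := Phi_proper.
have [subX subY] := prox_subgrad_stationary _ _ _ _ _ _ _ PhiNy Phi_closed hPhi hstat.
set M := adjoint A _ in subX subY.
have XY : Xt = Yt.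
  apply/eqP; rewrite -subr_eq0 -frob_inner_eq0; apply/eqP.
  pose W := adjoint A (A (Xt *m Yt^T)).
  have ME : M = W - adjoint A b by rewrite /M adjointB.
  have mono := prox_subgrad_monotone _ _ _ _ _ _ subX subY.
  have skew : 0 <= frob_inner ((W - W^T) *m Xt) (Xt - Yt).
    apply: (@skew_part_ge0 _ _ _ _ A); first by rewrite linearB /= trmxK opprB.
    by rewrite hii trmx_mul trmxK.
  have specW := frob_inner_mul_spectral W (Xt - Yt).
  have rhoB := rho_min_frob_inner _ (Xt - Yt) hi.
  (* Inserting [W X - W X] isolates the skew part [(W - W^T) X]; symmetry of [adjoint A b] merges
     its two contributions into one acting on [X - Y]. *)
  have sumE : - (M *m Yt + lambda *: (Xt - Yt)) - - (M^T *m Xt - lambda *: (Xt - Yt)) =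
      W *m (Xt - Yt) - (W - W^T) *m Xt - adjoint A b *m (Xt - Yt)
      - (2 * lambda) *: (Xt - Yt).
    rewrite ME [(W - _)^T]linearB /= hi !mulmxBl !mulmxBr mulrDl scalerDl mul1r.
    by apply/matrixP => i j; rewrite !mxE; ring.
  move: hgap; rewrite -/W -subr_gt0 => gap.
  rewrite sumE in mono; move: (Xt - Yt) mono skew specW rhoB => D.
  rewrite !frob_innerDl !frob_innerNl frob_innerZl => mono skew specW rhoB.
  (* If [|D|^2 > 0], the positive gap times [|D|^2] contradicts the sum of the four estimates. *)
  have := frob_inner_ge0 D; rewrite le0r => /orP[/eqP//|/(mulr_gt0 gap)]; lra.
split=> //; move: subX; rewrite /M -XY subrr scaler0 addr0.
apply: stationary_sym_objective; rewrite adjointB linearB /= hi; congr (_ - _).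
(* Symmetry of [M] comes from (ii) at [U = X X^T], for which [U - U^T = 0], together with (i). *)
apply/esym/eqP; rewrite -subr_eq0 hii trmx_mul trmxK subrr linear0.
by apply/eqP/matrixP => i j; rewrite !mxE frob_innerC frob_inner0l.
Qed.
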